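(* Let $m\geq 2$ be a square-free integer and $k\geq 2$ an integer. Let $(R_n)_{n=0}^\infty$ be a sequence of non-empty subsets of $\{0,1,\dots,m-1\}$ such that for every $n\geq 0$, all distinct $r,r'\in R_{n+1}$ and all $s,s'\in R_n$ we have \[ r-r'\not\equiv (s-s')^k \pmod m. \] Let \[\gamma=(k-1)\sum_{n=0}^{\infty}\frac{\log_m|R_n|}{k^{n+1}}.\] Then for every $\varepsilon>0$ there is a constant $c>0$ depending only on $m$ and $\varepsilon$ such that for every positive integer $N$ there exists a set $A\subseteq[N]$ containing no non-trivial configuration of the form $\{x,x+y,x+y^k\}$ and with $|A|\geq cN^{\gamma-\varepsilon}$.
   Context: $[N]=\{1,2,\dots,N\}$. A configuration $\{x,x+y,x+y^k\}$ in $A$ means integers $x,y$ with $x,x+y,x+y^k\in A$; it is non-trivial if $y\neq 0$. *)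

(* Defs.v *)
From mathcomp Require Import all_boot all_order all_algebra.
From mathcomp Require Import finmap.
From mathcomp Require Import all_classical all_reals all_analysis.

Set Implicit Arguments.
Unset Strict Implicit.
Unset Printing Implicit Defensive.

Import Order.TTheory GRing.Theory Num.Theory.
Import numFieldNormedType.Exports.
Local Open Scope ring_scope.

Definition square_free (m : nat) : Prop :=
  forall d : nat, (d ^ 2 %| m)%N -> d = 1%N.

Definition configuration_in (k : nat) (A : {fset int}) (x y : int) : Prop :=
  [/\ x \in A, x + y \in A & x + y ^+ k \in A].

Definition no_nontrivial_configuration (k : nat) (A : {fset int}) : Prop :=
  ~ exists x y : int, y != 0 /\ configuration_in k A x y.

(* The differences r - r' and s - s' are taken in int, not in nat. *)
Definition digit_condition (m k : nat) (D : nat -> {set 'I_m}) : Prop :=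
  forall (n : nat) (r r' s s' : 'I_m),
    r \in D n.+1 -> r' \in D n.+1 -> r != r' -> s \in D n -> s' \in D n ->
    ~ (r%:Z - r'%:Z = (s%:Z - s'%:Z) ^+ k %[mod m%:Z])%Z.

Definition logb {R : realType} (b x : R) : R := ln x / ln b.

(* For m >= 2, k >= 2 and nonempty D n, the terms lie between 0 and
   k ^- n.+1, so the series converges and limn is its sum. *)
Definition gamma (R : realType) (m k : nat) (D : nat -> {set 'I_m}) : R :=
  (k%:R - 1) *
  limn (series (fun n : nat => logb m%:R #|D n|%:R / k%:R ^+ n.+1 : R)).

(* Main.v *)
(* Let [f j] be the exponent of the largest power of [k] dividing [j], and take
   the integers [x + 1] where the base-[m] digits of [x] lie in [{0}] at
   position 0 and in [D (f j)] at each position [0 < j < L], with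
   [m ^ L <= N].  As [m] is square-free, if [m ^ j] exactly divides [y] then
   [m ^ (j * k)] exactly divides [y ^ k].  Hence [x + y] and [x] first differ at
   position [j], whereas [x + y ^ k] and [x] first differ at position [j * k],
   where the digit set is [D (f j).+1]; the digit condition excludes this.

   Positions with [f j = n] have density [(k - 1) / k ^ n.+1], so there are about
   [m ^ (L * gamma)] such integers.  To make the constant independent of [k]
   and [D], only the positions with [f j < T] are counted, where [2 ^- T <= eps]:
   rounding costs at most 1 for each [n < T], and the discarded part of the
   series of [gamma] is at most [k ^- T]. *)
Require Import Defs.
From mathcomp Require Import all_boot all_order all_algebra.
From mathcomp Require Import finmap.
From mathcomp Require Import zify ring lra.
From mathcomp Require Import all_classical all_reals all_analysis.

Set Implicit Arguments.
Unset Strict Implicit.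
Unset Printing Implicit Defensive.

Import Order.TTheory GRing.Theory Num.Theory.
Import numFieldNormedType.Exports.
Local Open Scope ring_scope.

(** * Divisibility by powers, and multiplicities *)

(** Each prime [p] of [m] occurs only to the first power, so it is enough that [p] divides [u ^ k],
    hence [u]. *)
Lemma square_free_dvdn_exp (m u k : nat) :
  (0 < m)%N -> square_free m -> (m %| u ^ k)%N -> (m %| u)%N.
Proof.
move=> m0 sf mu; apply/dvdn_partP => // p.
rewrite mem_primes => /and3P[p_pr _ pm].
have: (logn p m <= 1)%N.
  rewrite leqNgt -pfactor_dvdn //; apply/negP => /sf p1.
  by rewrite p1 in p_pr.
have pu : (p %| u)%N.
  by move: (dvdn_trans pm mu); rewrite Euclid_dvdX // => /andP[].
by rewrite p_part; case: (logn p m) => [|[|]] //; rewrite ?expn0 ?dvd1n ?expn1.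
Qed.

(** The base [b] may be composite, so this is not a [logn]. Searching below [n] suffices since
    [b ^ n > n] when [b > 1]. *)
Definition multiplicity (b n : nat) : nat :=
  find (fun e => ~~ (b ^ e.+1 %| n)%N) (iota 0 n).

Lemma multiplicityP (b n e : nat) : (1 < b)%N -> (0 < n)%N ->
  (b ^ e %| n)%N = (e <= multiplicity b n)%N.
Proof.
move=> b1 n0; set P := fun e => ~~ (b ^ e.+1 %| n)%N.
have hasP : has P (iota 0 n).
  apply/hasP; exists n.-1; first by rewrite mem_iota; lia.
  rewrite /P prednK //; apply/negP => /(dvdn_leq n0).
  by rewrite leqNgt ltn_expl.
have flt : (multiplicity b n < n)%N by rewrite -[ltnRHS](size_iota 0) -has_find.
have [le_e|lt_e] := leqP e (multiplicity b n).
  case: e le_e => [|e] le_e; first by rewrite expn0 dvd1n.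
  have := before_find 0%N le_e.
  by rewrite nth_iota ?add0n; [move/negbFE|lia].
apply/negP => be; have := nth_find 0%N hasP.
rewrite nth_iota ?add0n // => /negP; apply.
exact: dvdn_trans (dvdn_exp2l _ lt_e) be.
Qed.

(** This is what moves the index of the digit set from [n] at position [j] to [n.+1] at position
    [j * k]. *)
Lemma multiplicityM (b n : nat) : (1 < b)%N -> (0 < n)%N ->
  multiplicity b (n * b) = (multiplicity b n).+1.
Proof.
move=> b1 n0; have nb0 : (0 < n * b)%N by lia.
suff le e : (e <= multiplicity b (n * b))%N = (e <= (multiplicity b n).+1)%N.
  by apply/eqP; rewrite eqn_leq -le leqnn le leqnn.
rewrite -multiplicityP //; case: e => [|e]; first by rewrite expn0 dvd1n.
by rewrite ltnS -multiplicityP // expnSr dvdn_pmul2r //; lia.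
Qed.

(** * Integers with prescribed base-[m] digits *)

Fixpoint digit_sums (m : nat) (S : nat -> seq nat) (L : nat) : seq nat :=
  if L is l.+1 then [seq (a + d * m ^ l)%N | a <- digit_sums m S l, d <- S l]
  else [:: 0%N].

Section DigitSums.
Variables (m : nat) (S : nat -> seq nat).
Hypothesis S_lt : forall j d, d \in S j -> (d < m)%N.

Lemma digit_sums_lt L x : x \in digit_sums m S L -> (x < m ^ L)%N.
Proof.
elim: L x => [|L IH] x /=; first by rewrite inE => /eqP->.
case/allpairsP=> -[a d] /= [/IH aL /S_lt dm ->].
by rewrite expnS; nia.
Qed.

(** Remainder and quotient by [m ^ L] recover the lower digits and the top digit. *)
Lemma digit_sums_uniq L : (forall j, uniq (S j)) -> uniq (digit_sums m S L).
Proof.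
move=> uS; elim: L => [//|L IH] /=.
apply: allpairs_uniq => // -[a d] [a' d'] /allpairsP[[? ?] /= [aL _ [-> ->]]].
move=> /allpairsP[[? ?] /= [a'L _ [-> ->]]] /= eq_ad.
have {aL}aL := digit_sums_lt aL; have {a'L}a'L := digit_sums_lt a'L.
have mL0 : (0 < m ^ L)%N by lia.
move: (congr1 (modn ^~ (m ^ L)%N) eq_ad) (congr1 (divn ^~ (m ^ L)%N) eq_ad).
rewrite /= !(addnC _ (_ * _)%N) !modnMDl !divnMDl // !modn_small //.
by rewrite !divn_small // !addn0 => -> ->.
Qed.

Lemma size_digit_sums L :
  size (digit_sums m S L) = (\prod_(j < L) size (S j))%N.
Proof.
by elim: L => [|L IH] /=; rewrite ?big_ord0 // size_allpairs IH big_ord_recr.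
Qed.

Lemma digit_sums_dvd_eq L x x' : x \in digit_sums m S L ->
  x' \in digit_sums m S L -> ((m ^ L)%N%:Z %| x%:Z - x'%:Z)%Z -> x = x'.
Proof.
move=> /digit_sums_lt xL /digit_sums_lt x'L.
rewrite -eqz_mod_dvd !modz_small ?absz_nat; last 2 first.
- by lia.
- by lia.
by move/eqP => -[].
Qed.

(** Congruence modulo [m ^ j] makes all digits below position [j] agree, so the digits at [j] decide
    the difference modulo [m ^ j.+1]. In the induction the top digit either sits at position [j] or
    contributes a multiple of [m ^ j.+1]. *)
Lemma digit_sums_diff L j x x' : (j < L)%N -> x \in digit_sums m S L ->
  x' \in digit_sums m S L -> ((m ^ j)%N%:Z %| x%:Z - x'%:Z)%Z ->
  exists s s', [/\ s \in S j, s' \in S j &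
    ((m ^ j.+1)%N%:Z %| x%:Z - x'%:Z - (s%:Z - s'%:Z) * (m ^ j)%N%:Z)%Z].
Proof.
elim: L x x' => [//|L IH] x x'; rewrite ltnS leq_eqVlt /=.
move=> jL /allpairsP[[a d] /= [aL dS ->]] /allpairsP[[a' d'] /= [a'L d'S ->]].
have E : (a + d * m ^ L)%N%:Z - (a' + d' * m ^ L)%N%:Z =
    (a%:Z - a'%:Z) + (d%:Z - d'%:Z) * (m ^ L)%N%:Z.
  by rewrite !PoszD !PoszM; ring.
rewrite {}E; have [->|/= jL'] := eqVneq j L.
  rewrite rpredDr ?dvdz_mull // => aa'.
  rewrite (digit_sums_dvd_eq aL a'L aa').
  by exists d, d'; split => //; rewrite subrr add0r subrr dvdz0.
move: jL; rewrite (negbTE jL') /= => {}jL'.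
have mj1 : ((m ^ j.+1)%N%:Z %| (m ^ L)%N%:Z)%Z by rewrite dvdzE /= dvdn_exp2l.
have mj : ((m ^ j)%N%:Z %| (m ^ L)%N%:Z)%Z 
  by rewrite dvdzE /= dvdn_exp2l // ltnW.
rewrite rpredDr ?dvdz_mull // => /(IH _ _ jL' aL a'L)[s [s' [sS s'S H]]].
exists s, s'; split => //.
by rewrite addrAC rpredDr // dvdz_mull.
Qed.

End DigitSums.

(** * The configuration-free set *)

(** Position 0 is special because [0 * k = 0], so no index could increase there. Its single digit 0
    makes [m] divide every difference of two elements. *)
Definition digits {m : nat} (k : nat) (D : nat -> {set 'I_m}) (j : nat) :
    seq nat :=
  if j is 0%N then [:: 0%N] else [seq val i | i in D (multiplicity k j)].

Definition digit_fset {m : nat} (k : nat) (D : nat -> {set 'I_m}) (L : nat) :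
    {fset int} :=
  seq_fset tt [seq x%:Z + 1 | x <- digit_sums m (digits k D) L].

Section DigitSet.
Variables (m k : nat) (D : nat -> {set 'I_m}).
Hypothesis m_gt1 : (1 < m)%N.

Lemma digits_lt j d : d \in digits k D j -> (d < m)%N.
Proof.
case: j => [|j] /=; first by rewrite inE => /eqP->; exact: ltnW.
by case/mapP=> i _ ->; exact: ltn_ord.
Qed.

Lemma digits_uniq j : uniq (digits k D j).
Proof.
by case: j => [//|j]; rewrite map_inj_uniq ?enum_uniq //; exact: val_inj.
Qed.

Lemma digit_fsetP L x : x \in digit_fset k D L ->
  exists2 a, a \in digit_sums m (digits k D) L & x = a%:Z + 1.
Proof. by rewrite seq_fsetE => /mapP. Qed.

(** Position 0 contributes a factor 1. The bound is written [L.-1.+1] so that [L.-1] can serve as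
    [M] in [sum_multiplicity_ge]. *)
Lemma card_digit_fset L : #|` digit_fset k D L| =
  (\prod_(1 <= j < L.-1.+1) #|D (multiplicity k j)|)%N.
Proof.
rewrite size_seq_fset undup_id; last first.
  rewrite map_inj_uniq; last by move=> x y /addIr[].
  by apply: digit_sums_uniq; [exact: digits_lt|exact: digits_uniq].
rewrite size_map size_digit_sums; case: L => [|L].
  by rewrite big_ord0 big_geq.
rewrite big_ord_recl /= mul1n big_add1 /= big_mkord.
by apply: eq_bigr => j _; rewrite /bump /= add1n cardE size_map.
Qed.

Lemma digit_fset_range L x :
  x \in digit_fset k D L -> 1 <= x <= (m ^ L)%N%:Z.
Proof.
by move=> /digit_fsetP[a aL ->]; have := digit_sums_lt digits_lt aL; lia.
Qed.

Lemma digit_fset_dvd_eq L x z : x \in digit_fset k D L ->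
  x + z \in digit_fset k D L -> ((m ^ L)%N%:Z %| z)%Z -> z = 0.
Proof.
move=> /digit_fsetP[a aL ->] /digit_fsetP[b bL E].
have -> : z = b%:Z - a%:Z by lia.
by move=> /(digit_sums_dvd_eq digits_lt bL aL) ->; rewrite subrr.
Qed.

(** Serves twice: for [y] with cofactor [u] at position [j], and for [y ^ k] with cofactor [u ^ k]
    at position [j * k]. *)
Lemma digit_fset_diff L x j u : (j < L)%N -> x \in digit_fset k D L ->
  x + (m ^ j)%N%:Z * u \in digit_fset k D L ->
  exists s s', [/\ s \in digits k D j, s' \in digits k D j &
    (m%:Z %| u - (s%:Z - s'%:Z))%Z].
Proof.
move=> jL /digit_fsetP[a aL ->] /digit_fsetP[b bL E].
have ba : b%:Z - a%:Z = (m ^ j)%N%:Z * u by lia.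
have := digit_sums_diff digits_lt jL bL aL.
rewrite {}ba dvdz_mulr // => /(_ isT)[s [s' [sj s'j H]]].
exists s, s'; split => //; move: H.
rewrite [(_ * u)%R]mulrC -mulrBl expnS PoszM dvdz_mul2r //.
by rewrite eqz_nat -lt0n expn_gt0; lia.
Qed.

Lemma digit_fset_no_configuration L :
  (1 < k)%N -> square_free m -> digit_condition k D ->
  no_nontrivial_configuration k (digit_fset k D L).
Proof.
move=> k_gt1 sf Dcond [x [y [y0 [xA xyA xykA]]]].
have absy0 : (0 < `|y|)%N by rewrite absz_gt0.
set j := multiplicity m `|y|%N.
have mP e : ((m ^ e)%N%:Z %| y)%Z = (e <= j)%N.
  by rewrite dvdzE /= multiplicityP.
have jL : (j < L)%N.
  rewrite ltnNge -mP; apply/negP => /(digit_fset_dvd_eq xA xyA) /eqP.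
  by rewrite (negbTE y0).
have [u yE] : exists u, y = (m ^ j)%N%:Z * u.
  have := mP j; rewrite leqnn => /dvdzP[u ->]; exists u; exact: mulrC.
(* By the choice of [j], [m ^ j.+1] does not divide [y]. *)
have mu : ~ (m%:Z %| u)%Z.
  move=> mu; have := mP j.+1; rewrite ltnn => /negP; apply.
  by rewrite yE expnSr PoszM dvdz_mul.
(* Square-freeness enters here: with [ykE] below, no power of [m] beyond [m ^ (j * k)] divides
   [y ^ k]. *)
have muk : ~ (m%:Z %| u ^+ k)%Z.
  move=> H; apply: mu; rewrite dvdzE /=.
  by apply: (@square_free_dvdn_exp _ _ k) => //; [lia|rewrite -abszX].
have [s [s' [sj s'j us]]] : exists s s', [/\ s \in digits k D j,
    s' \in digits k D j & (m%:Z %| u - (s%:Z - s'%:Z))%Z].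
  by apply: (@digit_fset_diff L x) => //; rewrite -yE.
(* At position 0 both digits would be 0, and [m] would divide [u]. *)
have j0 : (0 < j)%N.
  rewrite lt0n; apply/negP => /eqP j0; move: sj s'j us.
  by rewrite j0 !inE => /eqP-> /eqP->; rewrite subrr subr0.
have ykE : y ^+ k = (m ^ (j * k))%N%:Z * u ^+ k.
  by rewrite yE exprMn expnM -[in RHS]natz natrX natz.
(* Otherwise [m ^ L] divides [y ^ k], a difference of two elements of the set, which forces
   [y ^ k = 0]. *)
have jkL : (j * k < L)%N.
  rewrite ltnNge; apply/negP => Ljk.
  have : y ^+ k = 0.
    apply: (digit_fset_dvd_eq xA xykA).
    by rewrite ykE dvdz_mulr // dvdzE /= dvdn_exp2l.
  by move/eqP; rewrite expf_eq0 (negbTE y0) andbF.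
have [r [r' [rj r'j ur]]] : exists r r', [/\ r \in digits k D (j * k),
    r' \in digits k D (j * k) & (m%:Z %| u ^+ k - (r%:Z - r'%:Z))%Z].
  by apply: (@digit_fset_diff L x) => //; rewrite -ykE.
have jk0 : (0 < j * k)%N by lia.
have digitsP i d : (0 < i)%N -> d \in digits k D i ->
    exists2 d' : 'I_m, d' \in D (multiplicity k i) & d = d'.
  by case: i => [//|i] _ /mapP[d' + ->]; rewrite mem_enum; exists d'.
have [t tD sE] := digitsP _ _ j0 sj; have [t' t'D s'E] := digitsP _ _ j0 s'j.
have [q qD rE] := digitsP _ _ jk0 rj; have [q' q'D r'E] := digitsP _ _ jk0 r'j.
rewrite multiplicityM // in qD q'D.
subst s s' r r'.
have qq' : q != q'.
  by apply/negP => /eqP qq'; apply: muk; move: ur; rewrite qq' subrr subr0.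
apply: (Dcond _ _ _ _ _ qD q'D qq' tD t'D).
apply/eqP.
(* Both [q - q'] and [(t - t') ^ k] are congruent to [u ^ k], against the digit condition. *)
have us' : (u ^+ k = (t%:Z - t'%:Z) ^+ k %[mod m%:Z])%Z.
  by rewrite -modzXm; move: us; rewrite -eqz_mod_dvd => /eqP->; rewrite modzXm.
by rewrite -us' eq_sym eqz_mod_dvd.
Qed.

End DigitSet.

(** * Density of the positions of given multiplicity *)

Section Density.
Variables (R : realType) (k : nat) (a : nat -> R).
Hypotheses (k_gt1 : (1 < k)%N) (a01 : forall n, 0 <= a n <= 1).

Let density (n : nat) : R := a n / k%:R ^+ n.+1.

Lemma divn_bounds (M d : nat) : (0 < d)%N ->
  M%:R / d%:R - 1 <= ((M %/ d)%:R : R) <= M%:R / d%:R.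
Proof.
move=> d0; have d0' : 0 < d%:R :> R by rewrite ltr0n.
rewrite lerBlDr ler_pdivrMr // ler_pdivlMr // natr1 -!natrM !ler_nat.
have := divn_eq M d; have := ltn_pmod M d0; nia.
Qed.

(** Among [1, ..., M] the multiplicity [n] occurs [M %/ k ^ n - M %/ k ^ n.+1] times, which is at
    least [M (k - 1) / k ^ n.+1 - 1]. As [a n <= 1], rounding costs at most 1 for each [n < T]. *)
Lemma sum_multiplicity_ge (M T : nat) :
  M%:R * ((k%:R - 1) * series density T) - T%:R <=
  \sum_(1 <= j < M.+1) a (multiplicity k j).
Proof.
have k0 : 0 < k%:R :> R by rewrite ltr0n; lia.
have kX0 e : (0 < k ^ e)%N by rewrite expn_gt0; lia.
have pick v : \sum_(0 <= n < T) a n * (n == v)%:R = a v * (v < T)%:R.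
  elim: T => [|t IH]; first by rewrite big_geq // mulr0.
  rewrite big_nat_recr //= IH ltnS [in RHS]leq_eqVlt [t == v]eq_sym.
  by have [->|_] := eqVneq v t; rewrite ?ltnn /= ?mulr0n ?mulr0 ?add0r ?addr0.
(* The difference of the two divisibility indicators is 1 exactly when [j] has multiplicity [n].
   Positions of multiplicity at least [T] are dropped, their terms being nonnegative. *)
apply: (@le_trans _ _ (\sum_(1 <= j < M.+1) \sum_(0 <= n < T)
    a n * ((k ^ n %| j)%N%:R - (k ^ n.+1 %| j)%N%:R))); last first.
  apply: ler_sum_nat => j /andP[j0 _].
  rewrite (eq_bigr (fun n => a n * (n == multiplicity k j)%:R)) => [|n _].
    rewrite pick; case: (_ < _)%N; rewrite ?mulr1 // mulr0.
    by case/andP: (a01 (multiplicity k j)).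
  rewrite !multiplicityP // leq_eqVlt; congr (_ * _).
  by have [<-|_] := eqVneq; rewrite ?ltnn /= ?subr0 ?subrr.
rewrite exchange_big /= /series /= !mulr_sumr.
have -> : T%:R = \sum_(0 <= n < T) 1 :> R by rewrite sumr_const_nat subn0.
rewrite -sumrB; apply: ler_sum_nat => n _.
rewrite -mulr_sumr sumrB -!natr_sum -!divn_count_dvd /density.
have /andP[+ _] := divn_bounds M (kX0 n).
have /andP[_ +] := divn_bounds M (kX0 n.+1).
set p := (M %/ k ^ n)%:R; set q := (M %/ k ^ n.+1)%:R => hq hp.
have -> : M%:R * ((k%:R - 1) * (a n / k%:R ^+ n.+1)) =
    a n * (M%:R / (k ^ n)%N%:R - M%:R / (k ^ n.+1)%N%:R) :> R.
  by rewrite !natrX exprS; field; rewrite expf_neq0 gt_eqF.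
have /andP[an0 an1] := a01 n.
have : a n * (M%:R / (k ^ n)%N%:R - M%:R / (k ^ n.+1)%N%:R - 1) <=
    a n * (p - q).
  by apply: ler_wpM2l => //; lra.
by rewrite mulrBr mulr1; lra.
Qed.

(** The geometric tail [(k - 1) / k ^ n.+1] over [n >= T] sums to [k ^- T]. Adding it to the scaled
    partial sums gives the nonincreasing sequence [u], so [u T] bounds all of them and hence the
    limit. *)
Lemma limn_series_density_le (T : nat) :
  (k%:R - 1) * limn (series density) <=
  (k%:R - 1) * series density T + (k%:R ^+ T)^-1.
Proof.
have k1 : 1 < k%:R :> R by rewrite ltr1n.
have k10 : 0 < k%:R - 1 :> R by rewrite subr_gt0.
have kX n : 0 < k%:R ^+ n :> R by rewrite exprn_gt0 //; lra.
pose u n := (k%:R - 1) * series density n + (k%:R ^+ n)^-1.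
have u_ni : nonincreasing_seq u.
  apply/nonincreasing_seqP => n; rewrite /u /series /= big_nat_recr //= mulrDr.
  have /andP[an0 an1] := a01 n.
  suff : (k%:R - 1) * density n + (k%:R ^+ n.+1)^-1 <= (k%:R ^+ n)^-1 by lra.
  have -> : (k%:R ^+ n)^-1 = ((k%:R - 1) + 1) * (k%:R ^+ n.+1)^-1 :> R.
    by rewrite exprS; field; rewrite gt_eqF ?gt_eqF //; lra.
  by rewrite [leRHS]mulrDl mul1r lerD2r ler_pM2l // /density ler_piMl.
have le_bd n : (T <= n)%N -> (k%:R - 1) * series density n <= u T.
  move=> Tn; apply: le_trans (u_ni _ _ Tn).
  by rewrite /u lerDl invr_ge0 ltW.
have s_nd : nondecreasing_seq (series density).
  apply/nondecreasing_seqP => n; rewrite /series /= big_nat_recr //= lerDl.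
  by rewrite /density mulr_ge0 ?invr_ge0 ?(ltW (kX _)) //; case/andP: (a01 n).
(* [le_bd] covers the indices from [T] on; monotonicity brings in the smaller ones. *)
have s_ub n : series density n <= u T / (k%:R - 1).
  apply: (@le_trans _ _ (series density (maxn T n))).
    by apply: s_nd; exact: leq_maxr.
  by rewrite ler_pdivlMr // mulrC le_bd // leq_maxl.
rewrite mulrC -ler_pdivlMr //; apply: limr_le.
  apply: nondecreasing_is_cvgn => //.
  by exists (u T / (k%:R - 1)) => _ [n _ <-]; exact: s_ub.
by near=> n; exact: s_ub.
Unshelve. all: by end_near.
Qed.

End Density.

(** * The size of the set, and the conclusion *)

Lemma ln_prod_nat (R : realType) (I : Type) (s : seq I) (F : I -> nat) :
  (forall i, (0 < F i)%N) ->
  ln (\prod_(i <- s) F i)%N%:R = \sum_(i <- s) ln (F i)%:R :> R.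
Proof.
move=> F0; elim: s => [|i s IH]; first by rewrite !big_nil ln1.
rewrite !big_cons natrM lnM ?IH // posrE ltr0n //.
by rewrite prodn_gt0.
Qed.

(** [T] is uniform in [k], since [k ^ T > T > 1 / eps] for every [k >= 2]. *)
Lemma exists_half_expn_le (R : realType) (eps : R) : 0 < eps ->
  exists T : nat, forall k : nat, (1 < k)%N -> (k%:R ^+ T)^-1 <= eps.
Proof.
move=> eps0; exists (Num.truncn eps^-1).+1 => k k1.
rewrite invf_ple ?posrE ?exprn_gt0 ?ltr0n //; last by lia.
apply: ltW; apply: lt_le_trans (truncnS_gt _) _.
by rewrite -natrX ler_nat ltnW // ltn_expl.
Qed.

(** Logarithms are compared. In the exponent [T.+2], the [T] pays for rounding, and the 2 for using
    [L.-1] positions although [N] may be close to [m ^ L.+1]. *)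
Lemma card_digit_fset_ge (R : realType) (m k T L N : nat)
    (D : nat -> {set 'I_m}) (eps : R) :
  (1 < m)%N -> (1 < k)%N -> (forall n, D n != finset.set0) ->
  0 < eps -> (k%:R ^+ T)^-1 <= eps -> (0 < N)%N -> (N < m ^ L.+1)%N ->
  (m%:R ^+ T.+2)^-1 * (N%:R `^ (gamma R k D - eps)) <=
  #|` digit_fset k D L|%:R.
Proof.
move=> m1 k1 D0 eps0 kT N0 NL.
have m0 : 0 < m%:R :> R by rewrite ltr0n; lia.
have lnm0 : 0 < ln m%:R :> R by rewrite ln_gt0 // ltr1n.
have cD0 n : (0 < #|D n|)%N by rewrite card_gt0.
pose a n : R := logb m%:R #|D n|%:R.
have lnD n : ln #|D n|%:R = a n * ln m%:R :> R.
  by rewrite /a /logb divfK // gt_eqF.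
have a01 n : 0 <= a n <= 1.
  rewrite /a /logb divr_ge0 ?(ltW lnm0) ?ln_ge0 ?ler1n //=.
  rewrite ler_pdivrMr // mul1r ler_ln ?posrE // ?ltr0n //.
  by rewrite ler_nat -[leqRHS]card_ord max_card.
(* Truncating at 0 gives [gamma <= 1], so the two lost positions cost at most a factor [m ^ 2]. *)
have g1 := limn_series_density_le k1 a01 0.
have gT := limn_series_density_le k1 a01 T.
rewrite -/(gamma R k D) in g1 gT.
have S := sum_multiplicity_ge k1 a01 L.-1 T.
set g := gamma R k D in g1 gT *.
rewrite /series /= big_geq // mulr0 expr0 invr1 add0r in g1.
have c0 : (0 < \prod_(1 <= j < L.-1.+1) #|D (multiplicity k j)|)%N.
  by rewrite prodn_gt0.
rewrite card_digit_fset //.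
(* For a negative exponent the left side is at most 1 and the set is nonempty. Otherwise bounds on
   [ln N] may be multiplied by [g - eps]. *)
have [lt0|ge0] := ltP (g - eps) 0.
  apply: (@le_trans _ _ 1); last by rewrite ler1n.
  rewrite -[leRHS]mulr1; apply: ler_pM;
    rewrite ?powR_ge0 ?invr_ge0 ?exprn_ge0 //.
  - by rewrite invf_le1 ?exprn_gt0 // exprn_ege1 // ler1n; lia.
  - by rewrite -[leRHS](powRr0 N%:R) ler_powR ?ler1n // ltW.
have NR0 : 0 < N%:R :> R by rewrite ltr0n.
rewrite -ler_ln ?posrE ?mulr_gt0 ?invr_gt0 ?exprn_gt0 ?powR_gt0 // ?ltr0n //.
rewrite lnM ?posrE ?invr_gt0 ?exprn_gt0 ?powR_gt0 // lnV ?posrE ?exprn_gt0 //.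
rewrite lnXn // ln_powR ln_prod_nat //.
under eq_bigr do rewrite lnD.
rewrite -mulr_suml.
have lnN : ln N%:R <= (L.-1%:R + 2) * ln m%:R :> R.
  rewrite -natrD mulrC mulr_natr -lnXn // -natrX.
  rewrite ler_ln ?posrE ?ltr0n ?expn_gt0 //; last by lia.
  by rewrite ler_nat; apply: leq_trans (ltnW NL) _; rewrite leq_pexp2l //; lia.
have h1 : (g - eps) * ln N%:R <= ((g - eps) * L.-1%:R + 2) * ln m%:R.
  apply: le_trans (ler_wpM2l ge0 lnN) _.
  rewrite mulrA ler_pM2r // mulrDr lerD2l.
  by rewrite -[leRHS]mul1r ler_pM2r //; lra.
(* By [gT] and [kT], stopping the series at [T] lowers [gamma] by at most [eps]. *)
have h2 : (g - eps) * L.-1%:R - T%:R <=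
    \sum_(1 <= j < L.-1.+1) a (multiplicity k j).
  apply: le_trans S; rewrite lerD2r mulrC; apply: ler_wpM2l => //; lra.
have := ler_wpM2r (ltW lnm0) h2.
rewrite -[ln m%:R *+ T.+2]mulr_natr -addn2 natrD; lra.
Qed.

Theorem theorem1p5 (R : realType) (m : nat) (hm : (2 <= m)%N)
    (hsf : square_free m) (eps : R) (heps : 0 < eps) :
  exists2 c : R, 0 < c &
    forall (k : nat) (D : nat -> {set 'I_m}),
      (2 <= k)%N ->
      (forall n : nat, D n != finset.set0) ->
      digit_condition k D ->
      forall N : nat, (0 < N)%N ->
        exists A : {fset int},
          [/\ forall x : int, x \in A -> 1 <= x <= N%:Z,
              no_nontrivial_configuration k A
            & c * (N%:R `^ (gamma R k D - eps)) <= (#|` A|)%:R].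
Proof.
(* [T] is fixed before [k] and [D], so the constant depends only on [m] and [eps]. *)
have [T hT] := exists_half_expn_le heps.
exists (m%:R ^+ T.+2)^-1; first by rewrite invr_gt0 exprn_gt0 // ltr0n; lia.
move=> k D k2 D0 Dcond N N0.
have /andP[mN Nm] := trunc_log_bounds hm N0.
exists (digit_fset k D (trunc_log m N)); split.
- by move=> x /(digit_fset_range hm)/andP[-> /= /le_trans]; apply;
  rewrite lez_nat.
- exact: digit_fset_no_configuration.
- exact: card_digit_fset_ge (hT _ k2) N0 Nm.
Qed.
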